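(* Let $\widehat{O}_t$ be a linear integro-differential operator acting on functions of the variable $t$. Let $k,r$ be real numbers, and let $f$ be a function such that $t\mapsto f(-rt)$ is in the domain of $\widehat{O}_t$ and $$\widehat{O}_t f(-rt) = -r\, f(-rt).$$ Set $b(t)=f(-rt)$. Then the function $$u(x,t)=e^{kx} f(-rt)$$ is a solution of the Burgers-type equation with variable coefficients $$\widehat{O}_t u+k\,e^{-kx}\,u\,u_x-b(t)\,u_{xx}+r\,u=0.$$
   Context: Here $u=u(x,t)$ is a function of two real variables, and subscripts $x$ denote partial derivatives in $x$. The operator $\widehat{O}_t$ is a general linear operator (for instance a differential, integral or fractional operator) acting only on the $t$ variable: for a function $u(x,t)$, $\widehat{O}_t u$ is obtained by applying $\widehat{O}_t$ to $t\mapsto u(x,t)$ for each fixed $x$, so that factors depending only on $x$ are treated as constants. The equality $\widehat{O}_t f(-rt)=-rf(-rt)$ means that the function $t\mapsto f(-rt)$ is an eigenfunction of $\widehat{O}_t$ with eigenvalue $-r$. *)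

(* Defs.v *)
From HB Require Import structures.
From mathcomp Require Import all_boot all_order all_algebra.
From mathcomp Require Import all_classical all_reals all_analysis.

Set Implicit Arguments.
Unset Strict Implicit.
Unset Printing Implicit Defensive.

Import Order.TTheory GRing.Theory Num.Theory.
Import numFieldNormedType.Exports.
Local Open Scope ring_scope.

(* A possibly unbounded linear operator on real functions of [t]: [op_dom] is a
   linear subspace of functions, and [op_fun] is constrained only on it (its
   values elsewhere are meaningless).  [R^o] is [R] as a module over itself. *)
Record linear_operator (R : realType) := LinearOperator {
  op_dom : submodClosed (R -> R^o) ;
  op_fun :> (R -> R^o) -> (R -> R^o) ;
  op_linear : forall (a : R) (g h : R -> R^o),
    g \in op_dom -> h \in op_dom ->
    op_fun (a *: g + h) = a *: op_fun g + op_fun h }.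

(* Functions of two variables are written [u x t]. *)
Definition apply_t (R : realType) (O : linear_operator R)
  (u : R -> R -> R) : R -> R -> R := fun x t => O (u x) t.

Definition partial_x (R : realType) (u : R -> R -> R) : R -> R -> R :=
  fun x t => derive1 (fun y : R => u y t) x.

(* [derive1] is total, so the existence of [u_x] and [u_xx], like the
   membership of [u x] in the domain of [O], has to be required explicitly. *)
Definition burgers_solution (R : realType) (O : linear_operator R)
    (k r : R) (b : R -> R) (u : R -> R -> R) : Prop :=
  [/\ forall x : R, (u x : R -> R^o) \in op_dom O,
      forall x t : R, derivable (fun y : R => u y t) x 1,
      forall x t : R, derivable (fun y : R => partial_x u y t) x 1
    & forall x t : R,
        apply_t O u x t + k * expR (- k * x) * u x t * partial_x u x t
        - b t * partial_x (partial_x u) x t + r * u x t = 0].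

(* Main.v *)
Require Import Defs.
From HB Require Import structures.
From mathcomp Require Import all_boot all_order all_algebra.
From mathcomp Require Import all_classical all_reals all_analysis.
From mathcomp Require Import ring.

Import Order.TTheory GRing.Theory Num.Theory.
Import numFieldNormedType.Exports.
Local Open Scope ring_scope.

(** Write [g t] for [f (- r * t)], so that [u x t = expR (k * x) * g t].  For
    fixed [x] the factor [expR (k * x)] is a scalar: linearity of [O]
    ([op_linear_scale]) turns the eigenvalue equation for [g] into
    [O u = - r u], which cancels the reaction term [r u].  Differentiation in
    [x] multiplies [u] by [k] ([partial_x_expR_mul]), so the convection term is
    [k e^(-kx) u (k u) = k^2 e^(kx) g^2]; the weight [e^(-kx)] removes one of
    the two exponentials.  The diffusion term is [g (k^2 u) = k^2 e^(kx) g^2]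
    as well, because its coefficient [b] is [g] itself, and these two cancel. *)

Lemma op_linear_scale (R : realType) (O : linear_operator R) (a : R)
    (g : R -> R^o) : g \in op_dom O -> O (a *: g) = a *: O g.
Proof.
move=> gO.
(* Splitting [a] as [(a - 1) + 1] gives the form [_ *: g + g] of [op_linear],
   without the detour through [O 0 = 0]. *)
have -> : a *: g = (a - 1) *: g + g by rewrite scalerBl scale1r subrK.
by rewrite op_linear// scalerBl scale1r subrK.
Qed.

Lemma is_derive_expR_mul (R : realType) (k c x : R) :
  is_derive x 1 (fun y : R => expR (k * y) * c) (k * (expR (k * x) * c)).
Proof.
have dk : is_derive x 1 (fun y : R => k * y) k.
  by apply: is_derive_eq; exact: mulr1.
have de : is_derive x 1 (fun y : R => expR (k * y)) (k * expR (k * x)).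
  by apply: is_derive_eq; exact: mulrC.
apply: is_derive_eq; rewrite scaler0 add0r mulrA; exact: mulrC.
Qed.

(** Being again of the form [expR (k * x) * h t], the derivative can be
    differentiated by the same rule to give [u_xx]. *)
Lemma partial_x_expR_mul (R : realType) (k : R) (g : R -> R) :
  partial_x (fun x t : R => expR (k * x) * g t) =
  (fun x t : R => expR (k * x) * (k * g t)).
Proof.
apply/funext => x; apply/funext => t; rewrite /partial_x derive1E.
by rewrite (@derive_val _ _ _ _ _ _ _ (is_derive_expR_mul _ k (g t) x)) mulrCA.
Qed.

Theorem proposition3p1 (R : realType) (O : linear_operator R) (k r : R)
    (f : R -> R)
    (fdom : ((fun t : R => f (- r * t)) : R -> R^o) \in op_dom O)
    (feigen : forall t : R, O (fun s : R => f (- r * s)) t = - r * f (- r * t)) :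
  burgers_solution O k r (fun t : R => f (- r * t))
    (fun x t : R => expR (k * x) * f (- r * t)).
Proof.
set g : R -> R^o := fun t => f (- r * t).
have uE x : (fun t : R => expR (k * x) * f (- r * t)) = expR (k * x) *: g.
  by [].
split.
- by move=> x; rewrite uE rpredZ.
- by move=> x t; case: (is_derive_expR_mul _ k (f (- r * t)) x).
- move=> x t; rewrite (partial_x_expR_mul _ k g).
  by case: (is_derive_expR_mul _ k (k * g t) x).
- move=> x t; rewrite !(partial_x_expR_mul _ k) /apply_t uE op_linear_scale//.
  rewrite -[(_ *: _) t]/(expR (k * x) * O g t) /g feigen.
  have eV : expR (- k * x) * expR (k * x) = 1 by rewrite -expRD mulNr addNr expR0.
  set E := expR (k * x) in eV *; set E' := expR (- k * x) in eV *.
  set y := f (- r * t).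
  transitivity ((E' * E - 1) * (k ^+ 2 * E * y ^+ 2)); first by ring.
  by rewrite eV subrr mul0r.
Qed.
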